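(* Let $\mathcal{E}$ be a topological VE-space over the topologically ordered $*$-space $Z$. Assume that the quotient normed VE-spaces $\mathcal{E}_p$ are barreled for all $p\in S_0(Z)$, where $S_0(Z)\subseteq S_*(Z)$ is a family defining the topology of $Z$. Let $\mathcal{F}$ be a topological VE-space over the same topologically ordered $*$-space $Z$. Then $\mathcal{L}^*(\mathcal{E},\mathcal{F})=\mathcal{L}_b^*(\mathcal{E},\mathcal{F},S_0(Z))$.
   Context: Ordered $*$-space: a complex vector space $Z$ with a conjugate linear involution $z\mapsto z^*$ and a convex cone $Z_+$ that is strict ($Z_+\cap -Z_+=\{0\}$) and consists of selfadjoint elements ($z^*=z$); for selfadjoint $z_1,z_2$, $z_1\ge z_2$ means $z_1-z_2\in Z_+$. Topologically ordered $*$-space: an ordered $*$-space $Z$ with a Hausdorff locally convex topology such that the involution is continuous, $Z_+$ is closed, and the topology is defined by a family of increasing seminorms, where a seminorm $p$ is increasing if $0\le x\le y$ implies $p(x)\le p(y)$. $S_*(Z)$ is the set of all continuous increasing seminorms $p$ on $Z$ with $p(z^* )=p(z)$ for all $z$; $S_*(Z)$ always generates the topology of $Z$. VE-space over $Z$: a complex vector space $\mathcal{E}$ with a map (gramian) $[\cdot,\cdot]\colon\mathcal{E}\times\mathcal{E}\to Z$ such that $[x,x]\ge 0$ with $[x,x]=0$ iff $x=0$, $[x,y]=[y,x]^*$, and $[\cdot,\cdot]$ is linear in the second variable. With the Hausdorff locally convex topology of the seminorms $\tilde p(x)=p([x,x])^{1/2}$, $p\in S_*(Z)$, it is called a topological VE-space.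 For $p\in S_*(Z)$, let $\tilde I_p=\{x\in\mathcal{E}\mid\tilde p(x)=0\}$, a linear subspace; $\mathcal{E}_p=\mathcal{E}/\tilde I_p$ is the quotient with the norm $\|x+\tilde I_p\|=\tilde p(x)$. It is barreled if this normed space is barreled (every closed, absorbent, balanced, convex set is a neighbourhood of $0$). A linear operator $T\colon\mathcal{E}\to\mathcal{F}$ is adjointable if there is a linear $T^*\colon\mathcal{F}\to\mathcal{E}$ with $[Te,f]_{\mathcal{F}}=[e,T^*f]_{\mathcal{E}}$ for all $e,f$; $\mathcal{L}^*(\mathcal{E},\mathcal{F})$ is the space of adjointable linear operators. $\mathcal{L}_b^*(\mathcal{E},\mathcal{F},S_0(Z))$ is the set of $T\in\mathcal{L}^*(\mathcal{E},\mathcal{F})$ such that for every $p\in S_0(Z)$ there is $C\ge0$ (depending on $T$ and $p$) with $\tilde p(Tx)\le C\tilde p(x)$ for all $x\in\mathcal{E}$. *)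

(* Defs.v *)
From HB Require Import structures.
From mathcomp Require Import all_boot all_order all_algebra.
From mathcomp Require Import generic_quotient ring_quotient complex.
From mathcomp Require Import boolp classical_sets functions reals.
From mathcomp Require Import convex topology normedtype.
From mathcomp Require Import ring.

Set Implicit Arguments.
Unset Strict Implicit.
Unset Printing Implicit Defensive.

Import Order.TTheory GRing.Theory Num.Theory.
Import numFieldNormedType.Exports.

Local Open Scope classical_set_scope.
Local Open Scope ring_scope.
Local Open Scope complex_scope.

(* The complex field is R[i] for a realType R; seminorms take values in R.
   On R[i] the norm `|a| is itself an element of R[i], hence the casts %:C. *)
Record seminorm (R : realType) (V : lmodType R[i]) (p : V -> R) : Prop := {
  seminormD : forall x y, p (x + y) <= p x + p y ;
  seminormZ : forall (a : R[i]) x, (p (a *: x))%:C = `|a| * (p x)%:C }.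

(* The topology of V is the one defined by the family of the seminorms q i, for
   i in D: finite intersections of balls form a neighbourhood basis at each
   point (n = 0 gives the whole space). *)
Definition topology_defined_by (R : realType) (V : topologicalLmodType R[i])
    (I : Type) (D : set I) (q : I -> V -> R) : Prop :=
  forall (x : V) (U : set V), nbhs x U <->
    exists n (i : 'I_n -> I) (e : R),
      [/\ forall k, D (i k), 0 < e &
          [set y | forall k, q (i k) (y - x) < e] `<=` U].

HB.mixin Record isOrderedStarSpace (R : realType) Z & GRing.Lmodule R[i] Z := {
  star : Z -> Z ;
  starK : involutive star ;
  starD : {morph star : x y / x + y} ;
  starZ : forall (a : R[i]) x, star (a *: x) = (a^*)%R *: star x ;
  pos : set Z ;
  posD : forall x y, pos x -> pos y -> pos (x + y) ;
  posZ : forall (t : R) x, 0 <= t -> pos x -> pos (t%:C *: x) ;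
  pos_strict : pos `&` (-%R @` pos) = [set 0] ;
  pos_selfadjoint : forall x, pos x -> star x = x }.

#[short(type="orderedStarType")]
HB.structure Definition OrderedStarSpace (R : realType) :=
  {Z of GRing.Lmodule R[i] Z & isOrderedStarSpace R Z}.

Definition star_le (R : realType) (Z : orderedStarType R) (x y : Z) : Prop :=
  [/\ star x = x, star y = y & pos (y - x)].

Definition increasing (R : realType) (Z : orderedStarType R) (p : Z -> R) :
    Prop :=
  forall x y, star_le 0 x -> star_le x y -> p x <= p y.

HB.mixin Record OrderedStarSpace_isTopological (R : realType) Z
    & OrderedStarSpace R Z & Tvs R[i] Z := {
  star_hausdorff : hausdorff_space Z ;
  star_continuous : continuous (star : Z -> Z) ;
  pos_closed : closed (pos : set Z) ;
  star_topology : exists D : set (Z -> R),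
    (forall p, D p -> seminorm p /\ increasing p) /\
    topology_defined_by D id }.

#[short(type="topOrderedStarType")]
HB.structure Definition TopOrderedStarSpace (R : realType) :=
  {Z of OrderedStarSpace R Z & Tvs R[i] Z & OrderedStarSpace_isTopological R Z}.

(* The elements of S_*(Z): a family S_0(Z) included in S_*(Z) is a set of
   elements of this type. *)
Record sstar (R : realType) (Z : topOrderedStarType R) := Sstar {
  sstar_fun :> Z -> R ;
  sstar_seminorm : seminorm sstar_fun ;
  sstar_continuous : continuous sstar_fun ;
  sstar_increasing : increasing sstar_fun ;
  sstar_star : forall z, sstar_fun (star z) = sstar_fun z }.

HB.mixin Record isVESpace (R : realType) (Z : orderedStarType R) E
    & GRing.Lmodule R[i] E := {
  gram : E -> E -> Z ;
  gram_ge0 : forall x, star_le 0 (gram x x) ;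
  gram_eq0 : forall x, gram x x = 0 <-> x = 0 ;
  gram_star : forall x y, gram x y = star (gram y x) ;
  gram_linear : forall x, linear (gram x) }.

#[short(type="veType")]
HB.structure Definition VESpace (R : realType) (Z : orderedStarType R) :=
  {E of GRing.Lmodule R[i] E & isVESpace R Z E}.

Definition ptilde (R : realType) (Z : topOrderedStarType R) (E : veType Z)
    (p : sstar Z) (x : E) : R :=
  Num.sqrt (p (gram x x)).

(* Hausdorffness is not repeated: it follows from gram_eq0 and star_hausdorff,
   because S_*(Z) defines the topology of Z. *)
HB.mixin Record VESpace_isTopological (R : realType) (Z : topOrderedStarType R)
    E & VESpace R Z E & Tvs R[i] E := {
  ve_topology : topology_defined_by [set: sstar Z] (@ptilde R Z E) }.

#[short(type="topVEType")]
HB.structure Definition TopVESpace (R : realType) (Z : topOrderedStarType R) :=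
  {E of VESpace R Z E & Tvs R[i] E & VESpace_isTopological R Z E}.

Section gramian.
Variables (R : realType) (Z : orderedStarType R) (E : veType Z).
Implicit Types (x y : E) (a : R[i]).

Lemma gramDr x y z : gram x (y + z) = gram x y + gram x z.
Proof. by have := gram_linear x 1 y z; rewrite !scale1r. Qed.

Lemma gramZr x a y : gram x (a *: y) = a *: gram x y.
Proof.
have g0 : gram x 0 = 0.
  by apply: (@addrI _ (gram x 0)); rewrite -gramDr !addr0.
by have := gram_linear x a y 0; rewrite g0 !addr0.
Qed.

Lemma gramDl x y z : gram (x + y) z = gram x z + gram y z.
Proof. by rewrite gram_star gramDr starD -!gram_star. Qed.

Lemma gramZl x a y : gram (a *: x) y = (a^*)%R *: gram x y.
Proof. by rewrite gram_star gramZr starZ -gram_star. Qed.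

Lemma star0 : star (0 : Z) = 0.
Proof. by apply: (@addrI _ (star (0 : Z))); rewrite -starD !addr0. Qed.

Lemma gram_pos x : pos (gram x x).
Proof. by have [_ _] := gram_ge0 x; rewrite subr0. Qed.

Lemma star_le0 (z : Z) : pos z -> star_le 0 z.
Proof. by move=> z0; split; rewrite ?star0 ?subr0//; exact: pos_selfadjoint. Qed.

End gramian.

Section ptilde_seminorm.
Variables (R : realType) (Z : topOrderedStarType R) (E : veType Z).
Variable p : sstar Z.
Implicit Types (x y : E) (a : R[i]) (z w : Z).

Lemma sstarZ_ge0 (t : R) z : 0 <= t -> p (t%:C *: z) = t * p z.
Proof.
move=> t0; apply/complexI; rewrite (seminormZ (sstar_seminorm p)).
by rewrite ger0_norm ?ler0c// rmorphM.
Qed.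

Lemma sstar_le z w : pos z -> pos (w - z) -> p z <= p w.
Proof.
move=> z0 wz; have w0 : pos w by rewrite -(subrK z w); exact: posD.
apply: (@sstar_increasing _ _ p); first exact: star_le0.
by split=> //; exact: pos_selfadjoint.
Qed.

Lemma sstar_ge0 z : pos z -> 0 <= p z.
Proof.
have p0 : p 0 = 0 by rewrite -(scale0r (0 : Z)) (@sstarZ_ge0 0)// mul0r.
move=> z0; rewrite -p0; apply: sstar_le; last by rewrite subr0.
by have := posZ 0 z (lexx 0) z0; rewrite scale0r.
Qed.

Lemma ptilde_ge0 x : 0 <= ptilde p x.
Proof. exact: sqrtr_ge0. Qed.

Lemma sqr_ptilde x : ptilde p x ^+ 2 = p (gram x x).
Proof. by rewrite sqr_sqrtr//; exact/sstar_ge0/gram_pos. Qed.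

Lemma ptildeZ a x : (ptilde p (a *: x))%:C = `|a| * (ptilde p x)%:C.
Proof.
have [r r0 ar] : exists2 r : R, 0 <= r & `|a| = r%:C.
  exists (Normc.normc a); last by [].
  by case: (a) => ? ?; exact: sqrtr_ge0.
rewrite ar -rmorphM; congr _%:C.
rewrite /ptilde gramZl gramZr scalerA [_ * a]mulrC -normCK ar -rmorphXn.
by rewrite sstarZ_ge0 ?exprn_ge0// sqrtrM ?exprn_ge0// sqrtr_sqr ger0_norm.
Qed.

(* (1 + t)[x, x] + (1 + t^-1)[y, y] - [x + y, x + y] = t [x - t^-1 y, x - t^-1 y] *)
Lemma sstar_gramD (t : R) x y : 0 < t ->
  p (gram (x + y) (x + y)) <=
  (1 + t) * p (gram x x) + (1 + t^-1) * p (gram y y).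
Proof.
move=> t0; have t1 : 0 <= 1 + t by rewrite addr_ge0// ltW.
have t2 : 0 <= 1 + t^-1 by rewrite addr_ge0// invr_ge0 ltW.
rewrite -(sstarZ_ge0 (gram x x) t1) -(sstarZ_ge0 (gram y y) t2).
apply: (le_trans _ (seminormD (sstar_seminorm p) _ _)).
apply: sstar_le; first exact: gram_pos.
have -> : (1 + t)%:C *: gram x x + (1 + t^-1)%:C *: gram y y
    - gram (x + y) (x + y)
  = t%:C *: gram (x - (t^-1)%:C *: y) (x - (t^-1)%:C *: y).
  have cR (r : R) : ((r%:C)^*)%R = r%:C :> R[i] by exact: conjc_real.
  rewrite -scaleNr -rmorphN !(gramDl, gramDr, gramZl, gramZr) /= cR.
  have ts : t%:C * (- t^-1)%:C = -1 :> R[i].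
    by rewrite -rmorphM mulrN mulfV ?gt_eqF// rmorphN.
  rewrite !scalerDr !scalerA ts mulN1r -!rmorphN opprK !rmorphD !scalerDl.
  rewrite !rmorphN !rmorph1 !scaleN1r !scale1r.
  set a := gram x x; set b := gram x y; set c := gram y x; set d := gram y y.
  rewrite /=; move: (_ *: a) (_ *: d) => u v.
  rewrite [- c + v]addrC [RHS]addrACA -opprD; apply/eqP; rewrite subr_eq.
  rewrite (addrACA a u d v) [c + d]addrC (addrACA a b d c) [b + c]addrC.
  by rewrite [_ + (c + b)]addrC [X in _ == X]addrA subrK addrC.
by apply: posZ; [exact: ltW|exact: gram_pos].
Qed.

Lemma ptildeD x y : ptilde p (x + y) <= ptilde p x + ptilde p y.
Proof.
apply/ler_addgt0Pr => e e0.
set A := ptilde p x + e / 2; set B := ptilde p y + e / 2.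
have A0 : 0 < A by rewrite ltr_wpDl ?ptilde_ge0// divr_gt0.
have B0 : 0 < B by rewrite ltr_wpDl ?ptilde_ge0// divr_gt0.
have [A1 B1] : 0 <= A /\ 0 <= B by split; exact: ltW.
have e1 : 0 <= e / 2 by rewrite divr_ge0// ltW.
have -> : ptilde p x + ptilde p y + e = A + B by rewrite addrACA -splitr.
rewrite -(@ler_pXn2r _ 2) ?nnegrE ?ptilde_ge0 ?addr_ge0//; [|exact: ptilde_ge0..].
rewrite sqr_ptilde; apply: (le_trans (@sstar_gramD _ x y (divr_gt0 B0 A0))).
have xA : p (gram x x) <= A ^+ 2.
  by rewrite -sqr_ptilde ler_pXn2r ?nnegrE ?ptilde_ge0// lerDl.
have yB : p (gram y y) <= B ^+ 2.
  by rewrite -sqr_ptilde ler_pXn2r ?nnegrE ?ptilde_ge0// lerDl.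
apply: (@le_trans _ _ ((1 + B / A) * A ^+ 2 + (1 + (B / A)^-1) * B ^+ 2)).
  by apply: lerD; rewrite ler_wpM2l// addr_ge0// ?invr_ge0 divr_ge0.
rewrite le_eqVlt; apply/orP; left; apply/eqP.
have [? ?] : A != 0 /\ B != 0 by rewrite !gt_eqF.
by field; rewrite ?mulf_neq0//; apply/andP.
Qed.

End ptilde_seminorm.

Section normed_quotient.
Variables (R : realType) (Z : topOrderedStarType R) (E : veType Z).
Variable p : sstar Z.

Definition ptilde_ker : {pred E} := [pred x | ptilde p x == 0].

Lemma ptilde_kerP x : reflect (ptilde p x = 0) (x \in ptilde_ker).
Proof. by rewrite inE; exact: eqP. Qed.

Lemma ptilde_ker_submod : submod_closed ptilde_ker.
Proof.
split=> [|a x y /ptilde_kerP x0 /ptilde_kerP y0]; apply/ptilde_kerP.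
  by apply/complexI; rewrite -(scale0r (0 : E)) ptildeZ normr0 mul0r.
apply/le_anti; rewrite ptilde_ge0 andbT; apply: (le_trans (ptildeD _ _ _)).
have /complexI -> : (ptilde p (a *: x))%:C = 0%:C :> R[i].
  by rewrite ptildeZ x0 mulr0.
by rewrite y0 addr0.
Qed.

HB.instance Definition _ :=
  GRing.isSubmodClosed.Build R[i] E ptilde_ker ptilde_ker_submod.

(* E_p; its norm is ptilde p by ve_quotient_norm_pi. *)
Definition ve_quotient := Quotient.quot (ptilde_ker : zmodClosed E).

HB.instance Definition _ := GRing.Zmodule.on ve_quotient.

Definition ve_pi (x : E) : ve_quotient := (\pi_ve_quotient x)%qT.
Definition ve_repr (q : ve_quotient) : E := repr q.

Lemma ve_reprK q : ve_pi (ve_repr q) = q.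
Proof. exact: reprK. Qed.

Lemma ve_piP x y : ve_pi x = ve_pi y <-> x - y \in ptilde_ker.
Proof.
rewrite (Quotient.idealrBE (ptilde_ker : zmodClosed E)).
by split=> [/eqP|/eqP].
Qed.

Lemma ve_piD : {morph ve_pi : x y / x + y}.
Proof. by move=> x y; rewrite /ve_pi piE. Qed.

Definition ve_quotient_scale (a : R[i]) (q : ve_quotient) : ve_quotient :=
  ve_pi (a *: ve_repr q).

Lemma ve_piZ a x : ve_pi (a *: x) = ve_quotient_scale a (ve_pi x).
Proof.
apply/ve_piP; rewrite -scalerBr rpredZ//.
by apply/ve_piP; rewrite ve_reprK.
Qed.

Lemma ve_quotient_scaleA a b q :
  ve_quotient_scale a (ve_quotient_scale b q) = ve_quotient_scale (a * b) q.
Proof. by rewrite -[q]ve_reprK -!ve_piZ scalerA. Qed.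

Lemma ve_quotient_scale1 : left_id 1 ve_quotient_scale.
Proof. by move=> q; rewrite -[q]ve_reprK -ve_piZ scale1r. Qed.

Lemma ve_quotient_scaleDr : right_distributive ve_quotient_scale +%R.
Proof.
move=> a q r; rewrite -[q]ve_reprK -[r]ve_reprK.
by rewrite -ve_piD -!ve_piZ -ve_piD scalerDr.
Qed.

Lemma ve_quotient_scaleDl q : {morph ve_quotient_scale^~ q : a b / a + b}.
Proof. by move=> a b; rewrite -[q]ve_reprK -!ve_piZ -ve_piD scalerDl. Qed.

HB.instance Definition _ := GRing.Zmodule_isLmodule.Build R[i] ve_quotient
  ve_quotient_scaleA ve_quotient_scale1 ve_quotient_scaleDr ve_quotient_scaleDl.

Definition ve_quotient_norm (q : ve_quotient) : R[i] :=
  (ptilde p (ve_repr q))%:C.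

Lemma ve_quotient_norm_pi x : ve_quotient_norm (ve_pi x) = (ptilde p x)%:C.
Proof.
have le_pi y z : ve_pi y = ve_pi z -> ptilde p y <= ptilde p z.
  move=> /ve_piP/ptilde_kerP yz; rewrite -[y](subrK z).
  by rewrite (le_trans (ptildeD _ _ _))// yz add0r.
by congr _%:C; apply/le_anti; rewrite !le_pi ?ve_reprK.
Qed.

Lemma ve_quotient_normD q r :
  ve_quotient_norm (q + r) <= ve_quotient_norm q + ve_quotient_norm r.
Proof.
rewrite -[q]ve_reprK -[r]ve_reprK -ve_piD !ve_quotient_norm_pi -rmorphD.
by rewrite lecR ptildeD.
Qed.

Lemma ve_quotient_normZ a q :
  ve_quotient_norm (a *: q) = `|a| * ve_quotient_norm q.
Proof.
rewrite -[q]ve_reprK ve_quotient_norm_pi -ptildeZ -ve_quotient_norm_pi.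
by rewrite ve_piZ.
Qed.

Lemma ve_quotient_norm_eq0 q : ve_quotient_norm q = 0 -> q = 0.
Proof.
move=> /complexI q0; have -> : 0 = ve_pi 0 by rewrite /ve_pi piE.
rewrite -[q]ve_reprK.
by apply/ve_piP; rewrite subr0; exact/ptilde_kerP.
Qed.

HB.instance Definition _ := Lmodule_isNormed.Build R[i] ve_quotient
  ve_quotient_normD ve_quotient_normZ ve_quotient_norm_eq0.

End normed_quotient.

Definition absorbent (K : numDomainType) (V : lmodType K) (B : set V) : Prop :=
  forall x, exists2 r : K, 0 < r &
    forall a : K, r <= `|a| -> exists2 y, B y & x = a *: y.

Definition balanced (K : numDomainType) (V : lmodType K) (B : set V) : Prop :=
  forall (a : K) x, `|a| <= 1 -> B x -> B (a *: x).

Definition barreled (K : numFieldType) (V : normedModType K) : Prop :=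
  forall B : set V, closed B -> absorbent B -> balanced B ->
    convex_set B -> nbhs 0 B.

Section adjointable.
Variables (R : realType) (Z : topOrderedStarType R) (E F : veType Z).

Definition adjointable : set {linear E -> F} :=
  [set T | exists Tstar : {linear F -> E},
    forall e f, gram (T e) f = gram e (Tstar f)].

Definition bounded_adjointable (S0 : set (sstar Z)) : set {linear E -> F} :=
  [set T | adjointable T /\ forall p, S0 p ->
    exists2 C : R, 0 <= C & forall x, ptilde p (T x) <= C * ptilde p x].

End adjointable.

Arguments adjointable {R Z} E F _.
Arguments bounded_adjointable {R Z} E F S0 _.

(* Main.v *)
(* Polarization gives p [x, y] <= (p~ x + p~ y)^2, so each functional
   x |-> p [T^* y, x] = p [y, T x] is a continuous seminorm on E_p. For fixed x
   these seminorms stay bounded when p~ y <= 1, hence they are uniformly bounded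
   because E_p is barreled; taking y = T x / p~ (T x) turns the uniform bound
   into p~ (T x) <= C p~ x. *)

Require Import Defs.
From mathcomp Require Import all_boot all_order all_algebra.
From mathcomp Require Import complex boolp classical_sets reals topology normedtype.
From mathcomp Require Import interval_inference convex.

Local Open Scope classical_set_scope.

Import Order.TTheory GRing.Theory Num.Theory.

(** * Real-valued seminorms on complex vector spaces *)

Section seminorms.
Local Open Scope ring_scope.
Local Open Scope complex_scope.
Context {R : realType} {V : lmodType R[i]}.
Implicit Types (q s : V -> R) (x : V).

Lemma seminormZr q (t : R) x : seminorm q -> 0 <= t ->
  q (t%:C *: x) = t * q x.
Proof.
move=> qs t0; apply: (@complexI R); rewrite (seminormZ qs).
by rewrite ger0_norm ?ler0c// rmorphM.
Qed.

Lemma seminorm0 q : seminorm q -> q 0 = 0.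
Proof. by move=> qs; rewrite -(scale0r (0 : V)) (seminormZr q 0)// mul0r. Qed.

Lemma seminormN q x : seminorm q -> q (- x) = q x.
Proof.
move=> qs; apply: (@complexI R).
by rewrite -scaleN1r (seminormZ qs) normrN1 mul1r.
Qed.

Lemma seminorm_ge0 q x : seminorm q -> 0 <= q x.
Proof.
move=> qs; have := seminormD qs x (- x).
by rewrite subrr seminorm0// seminormN// -mulr2n pmulrn_lge0.
Qed.

(** Homogeneity: scaling [x] by [d / (s x + e)] moves it into the ball where [q] is at most [M];
    then [e] tends to 0. The slack [e > 0] also covers the case [s x = 0]. *)
Lemma seminorm_le_dominated q s (d M : R) : seminorm q -> seminorm s ->
  0 < d -> (forall x, s x < d -> q x <= M) ->
  forall x, q x <= M / d * s x.
Proof.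
move=> qs ss d0 qM x.
have M0 : 0 <= M by rewrite -(seminorm0 q qs) qM// seminorm0.
have C0 : 0 <= M / d by rewrite divr_ge0// ltW.
have le_e e : 0 < e -> q x <= M / d * (s x + e).
  move=> e0; have se0 : 0 < s x + e by rewrite ltr_wpDl// seminorm_ge0.
  have t0 : 0 < d / (s x + e) by rewrite divr_gt0.
  have := qM ((d / (s x + e))%:C *: x); rewrite !seminormZr ?(ltW t0)//.
  rewrite mulrAC ltr_pdivrMr// ltr_pM2l// ltrDl => /(_ e0).
  by rewrite mulrAC ler_pdivrMr// -ler_pdivlMl// mulrA [_^-1 * _]mulrC.
apply/ler_addgt0Pr => e e0.
(* The slack [e / (M / d + 1)] contributes at most [e] after multiplication by [M / d]; the added 1
   avoids dividing by 0 when [M = 0]. *)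
have d1 : 0 < M / d + 1 by rewrite ltr_wpDl.
apply: (le_trans (le_e (e / (M / d + 1)) _)); first exact: divr_gt0.
rewrite mulrDr lerD2l mulrCA ler_piMr ?(ltW e0)//.
by rewrite ler_pdivrMr// mul1r lerDl.
Qed.

End seminorms.

(** * Uniform boundedness for seminorms on a barreled normed space *)

Section barreled.
Local Open Scope ring_scope.
Local Open Scope complex_scope.
Context {R : realType} {V : normedModType R[i]}.

Lemma Re_normE (x : V) : (@complex.Re R `|x|)%:C = `|x|.
Proof. by rewrite RRe_real// normr_real. Qed.

Lemma seminorm_Re_norm : seminorm (fun x : V => @complex.Re R `|x|).
Proof.
split=> [x y|a x]; first by rewrite -lecR rmorphD/= !Re_normE ler_normD.
by rewrite !Re_normE normrZ.
Qed.

(** The common unit ball [B] of the family is a barrel, so it contains an open ball of some radius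
    [d] around 0, and rescaling gives the constant [1 / d]. *)
Lemma barreled_bounded (Q : set (V -> R)) : barreled V ->
  (forall q, Q q -> seminorm q) ->
  (forall q, Q q -> exists2 C, 0 <= C & forall x, q x <= C * @complex.Re R `|x|) ->
  (forall x, exists C, forall q, Q q -> q x <= C) ->
  exists2 C, 0 <= C & forall q, Q q -> forall x, q x <= C * @complex.Re R `|x|.
Proof.
move=> bV Qs Qc Qb; pose B : set V := [set x | forall q, Q q -> q x <= 1].
have /nbhs_norm0P[d /= d0 dB] : nbhs 0 B.
  apply: bV.
  (* Closed: a point [y] of [B] within [e / (C + 1)] of [x] gives
     [q x <= q (x - y) + q y <= e + 1]. *)
  - move=> x xB q Qq; have [C C0 qC] := Qc q Qq.
    apply/ler_addgt0Pr => e e0; have C1 : 0 < C + 1 by rewrite ltr_wpDl.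
    have d0 : 0 < (e / (C + 1))%:C :> R[i] by rewrite ltcR divr_gt0.
    have [y [By xy]] := xB _ (nbhsx_ballx x _ d0).
    rewrite -[x](subrK y) (le_trans (seminormD (Qs q Qq) _ _))//.
    rewrite addrC lerD//; first exact: By.
    apply: (le_trans (qC _)); move: xy; rewrite -ball_normE/= -Re_normE ltcR.
    move=> /ltW xy; apply: (le_trans (ler_wpM2l C0 xy)).
    by rewrite mulrCA ler_piMr ?(ltW e0)// ler_pdivrMr// mul1r lerDl.
  (* Absorbent: the pointwise bound at [x] serves as the radius; the maximum with 1 makes it
     positive. *)
  - move=> x; have [C qC] := Qb x.
    have C0 : 0 < Num.max C 1 by rewrite lt_max ltr01 orbT.
    exists (Num.max C 1)%:C; first by rewrite ltcR.
    move=> a aC; have a0 : a != 0.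
      by rewrite -normr_gt0 (lt_le_trans _ aC)// ltcR.
    exists (a^-1 *: x); last by rewrite scalerA mulfV// scale1r.
    move=> q Qq; rewrite -lecR (seminormZ (Qs q Qq)) normfV.
    rewrite mulrC ler_pdivrMr ?normr_gt0// mul1r (le_trans _ aC)// lecR.
    by rewrite le_max qC.
  - move=> a x a1 Bx q Qq; have q0 := seminorm_ge0 q x (Qs q Qq).
    rewrite -lecR (seminormZ (Qs q Qq)).
    apply: (@le_trans _ _ (1 * (q x)%:C)); first by rewrite ler_wpM2r// ler0c.
    by rewrite mul1r lecR Bx.
  - move=> x y l; rewrite !inE => Bx By q Qq.
    have l0 : 0 <= l%:num by [].
    have l1 : 0 <= 1 - l%:num by rewrite subr_ge0.
    rewrite /conv/=.
    apply: (le_trans (seminormD (Qs q Qq) _ _)).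
    rewrite -lecR rmorphD/= !(seminormZ (Qs q Qq)) !ger0_norm//.
    rewrite -[leRHS](subrKC l%:num) lerD// ler_piMr// lecR; first exact: Bx.
    exact: By.
(* The radius [d] is an element of [R[i]], but being positive it is real. *)
have dE : (complex.Re d)%:C = d by rewrite RRe_real// gtr0_real.
have d1 : 0 < complex.Re d by rewrite -ltcR dE.
exists (complex.Re d)^-1; first by rewrite invr_ge0 ltW.
move=> q Qq x; rewrite -[_^-1]mul1r.
apply: (seminorm_le_dominated q (fun x => @complex.Re R `|x|)) => //.
- exact: Qs.
- exact: seminorm_Re_norm.
- by move=> y yd; apply: dB => //=; rewrite -Re_normE -dE ltcR.
Qed.

End barreled.

(** * Estimates for the gramian and boundedness of adjointable operators *)

Section gramian_bounds.
Local Open Scope ring_scope.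
Local Open Scope complex_scope.
Context {R : realType} {Z : topOrderedStarType R}.
Implicit Types p : sstar Z.

Lemma ptilde_seminorm (E : veType Z) p : seminorm (@ptilde R Z E p).
Proof. by split=> [x y|a x]; [exact: ptildeD|exact: ptildeZ]. Qed.

Lemma gram_seminorm (E : veType Z) p (z : E) :
  seminorm (fun x => p (gram z x)).
Proof.
split=> [x y|a x]; first by rewrite gramDr (seminormD (sstar_seminorm p)).
by rewrite gramZr (seminormZ (sstar_seminorm p)).
Qed.

(** With [b = [x, y]] and [c = [y, x]], the first difference is [2 (b + c)]. Linearity in the second
    variable makes the other one [2 'i (b - c)], hence the minus sign before ['i]. *)
Lemma gram_polarization (E : veType Z) (x y : E) :
  4%:R *: gram x y = (gram (x + y) (x + y) - gram (x - y) (x - y)) -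
    'i *: (gram (x + 'i *: y) (x + 'i *: y) -
           gram (x - 'i *: y) (x - 'i *: y)).
Proof.
have diff (u v : E) : gram (u + v) (u + v) - gram (u - v) (u - v) =
    2%:R *: (gram u v + gram v u).
  rewrite -[- v]scaleN1r !(gramDl, gramDr, gramZl, gramZr).
  rewrite rmorphN rmorph1 !scaleN1r opprK.
  rewrite scaler_nat mulr2n.
  move: (gram u u) (gram u v) (gram v u) (gram v v) => a b c d.
  rewrite opprD opprB opprD opprK addrACA [a + b]addrC.
  rewrite (addrACA b a b) (addrACA c d c) !subrr !addr0.
  by rewrite addrACA.
rewrite !diff gramZl gramZr conjCi.
have scale_i (K : numClosedFieldType) (V : lmodType K) (b c : V) :
    4%:R *: b = 2%:R *: (b + c) - 'i *: (2%:R *: ('i *: b + - 'i *: c)).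
  have ii (z : K) : 'i * (z * 'i) = - z by rewrite mulrCA -expr2 sqrCi mulrN1.
  rewrite !scalerDr !scalerA !mulrN -!mulrA ii opprK.
  rewrite opprD -!scaleNr opprK addrACA -!scalerDl subrr scale0r addr0.
  by rewrite -natrD.
exact: scale_i.
Qed.

(** A substitute for the Schwarz inequality: each of the four polarization terms is a gramian square
    of [x + c y] with [|c| = 1], so subadditivity of [ptilde p] bounds it by the right-hand side,
    and the factor 4 cancels. *)
Lemma sstar_gram_le (E : veType Z) p (x y : E) :
  p (gram x y) <= (ptilde p x + ptilde p y) ^+ 2.
Proof.
have ps := sstar_seminorm p.
have le_sqr (c : R[i]) : `|c| = 1 ->
    p (gram (x + c *: y) (x + c *: y)) <= (ptilde p x + ptilde p y) ^+ 2.
  move=> c1; rewrite -sqr_ptilde ler_pXn2r ?nnegrE ?addr_ge0 ?ptilde_ge0//.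
  apply: (le_trans (ptildeD _ _ _)); rewrite lerD2l -lecR ptildeZ c1 mul1r.
  by [].
rewrite -(ler_pM2l (ltr0n R 4)) -seminormZr//.
have -> : 4%:R%:C = 4%:R :> R[i] by rewrite rmorph_nat.
rewrite gram_polarization.
have leB u v : p (u - v) <= p u + p v.
  by rewrite (le_trans (seminormD ps _ _))// seminormN.
have i1 : `|'i : R[i]| = 1 by rewrite normCi.
have -> b : 4%:R * b = b + b + (b + b) :> R.
  by rewrite mulr_natl !mulrS mulr0n addr0 !addrA.
apply: (le_trans (leB _ _)); apply: lerD.
  apply: (le_trans (leB _ _)); rewrite -[y in x + y]scale1r -scaleN1r.
  by apply: lerD; apply: le_sqr; rewrite ?normrN normr1.
have -> u : p ('i *: u) = p u.
  by apply: (@complexI R); rewrite (seminormZ ps) i1 mul1r.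
apply: (le_trans (leB _ _)); rewrite -scaleNr.
by apply: lerD; apply: le_sqr; rewrite ?normrN.
Qed.

(** On the ball [ptilde p x < 1] the quadratic estimate is a constant, and homogeneity makes it a
    linear bound. *)
Lemma sstar_gram_bounded (E : veType Z) p (z : E) :
  exists2 C, 0 <= C & forall x, p (gram z x) <= C * ptilde p x.
Proof.
exists ((ptilde p z + 1) ^+ 2).
  by rewrite exprn_ge0// addr_ge0// ptilde_ge0.
move=> x; rewrite -[_ ^+ 2]divr1.
apply: (seminorm_le_dominated _ (@ptilde R Z E p) 1 _ (gram_seminorm E p z)).
- exact: ptilde_seminorm.
- by [].
move=> {}x x1; apply: (le_trans (sstar_gram_le E p z x)).
by rewrite ler_pXn2r ?nnegrE ?addr_ge0 ?ptilde_ge0// lerD2l ltW.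
Qed.

Lemma norm_ve_pi (E : veType Z) p (x : E) :
  `|ve_pi p x| = (ptilde p x)%:C :> R[i].
Proof. exact: ve_quotient_norm_pi. Qed.

Lemma barreled_adjoint_bounded (E F : veType Z) p (T : {linear E -> F})
    (Tstar : F -> E) :
  (forall e f, gram (T e) f = gram e (Tstar f)) ->
  barreled (ve_quotient E p) ->
  exists2 C : R, 0 <= C & forall x, ptilde p (T x) <= C * ptilde p x.
Proof.
move=> TT bE.
have TTstar y x : gram (Tstar y) x = gram y (T x).
  by rewrite gram_star -TT -gram_star.
pose q y (u : ve_quotient E p) := p (gram (Tstar y) (ve_repr u)).
(* Independence of the representative: two representatives differ by an element of the kernel of
   [ptilde p], where the linear bound forces the functional to vanish. *)
have q_pi y x : q y (ve_pi p x) = p (gram (Tstar y) x).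
  have gs := gram_seminorm E p (Tstar y).
  have [C C0 qC] := sstar_gram_bounded E p (Tstar y).
  have le_pi u v : ve_pi p u = ve_pi p v ->
      p (gram (Tstar y) u) <= p (gram (Tstar y) v).
    move=> /ve_piP/ptilde_kerP uv; rewrite -[u](subrK v).
    apply: (le_trans (seminormD gs _ _)); rewrite gerDr.
    by apply: (le_trans (qC _)); rewrite uv mulr0.
  by apply/le_anti; rewrite !le_pi ?ve_reprK.
have [||||C C0 qC] := @barreled_bounded R (ve_quotient E p)
    [set q y | y in [set y : F | ptilde p y <= 1]].
- exact: bE.
- move=> _ [y _ <-]; have gs := gram_seminorm E p (Tstar y).
  split=> [u v|a u]; rewrite -[u]ve_reprK.
    by rewrite -[v]ve_reprK -ve_piD !q_pi (seminormD gs).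
  by rewrite -[X in q y X](ve_piZ p a (ve_repr u)) !q_pi (seminormZ gs).
- move=> _ [y _ <-]; have [C C0 qC] := sstar_gram_bounded E p (Tstar y).
  by exists C => // u; rewrite -[u]ve_reprK q_pi norm_ve_pi.
(* Moving the adjoint back to [T] turns the value into [p [y, T x]] for the representative [x] of
   [u]; as [ptilde p y <= 1], its bound does not depend on [y]. *)
- move=> u; exists ((1 + ptilde p (T (ve_repr u))) ^+ 2) => _ [y y1 <-].
  rewrite /q TTstar; apply: (le_trans (sstar_gram_le F p _ _)).
  by rewrite ler_pXn2r ?nnegrE ?addr_ge0 ?ptilde_ge0// lerD2r.
exists C => // x; have [->|Tx0] := eqVneq (ptilde p (T x)) 0.
  by rewrite mulr_ge0// ptilde_ge0.
have Tx_gt0 : 0 < ptilde p (T x) by rewrite lt_def Tx0 ptilde_ge0.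
have conj_real (r : R) : ((r%:C)^*)%R = r%:C :> R[i] by exact: conjc_real.
(* For [y = t T x] one has [ptilde p y = 1], and [p [y, T x] = t (ptilde p (T x))^2 = ptilde p (T
   x)]. *)
set t := (ptilde p (T x))^-1; have t0 : 0 <= t by rewrite invr_ge0 ltW.
have := qC (q (t%:C *: T x)) _ (ve_pi p x); rewrite norm_ve_pi q_pi /=.
rewrite TTstar gramZl conj_real sstarZ_ge0// -sqr_ptilde.
rewrite expr2 mulrA mulVf// mul1r; apply.
exists (t%:C *: T x) => //=.
by rewrite (seminormZr _ _ _ (ptilde_seminorm F p))// mulVf.
Qed.

End gramian_bounds.

Theorem corollary3p8 (R : realType) (Z : topOrderedStarType R)
    (E F : topVEType Z) (S0 : set (sstar Z)) :
  topology_defined_by S0 (@sstar_fun R Z) ->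
  (forall p, S0 p -> barreled (ve_quotient E p)) ->
  adjointable E F = bounded_adjointable E F S0.
Proof.
move=> _ bE; apply/seteqP; split=> T; last by case.
move=> [Tstar TT]; split=> [|p S0p]; first by exists Tstar.
exact: (barreled_adjoint_bounded _ _ _ _ _ TT (bE p S0p)).
Qed.
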